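(* The class $\mathsf{ICM}$ of implicitly closed meadows is the Beth companion of the quasivariety $\mathsf{RCR}$ of reduced commutative rings, and this Beth companion is simple. More precisely, $\mathsf{ICM}$ is a simple pp expansion of $\mathsf{RCR}$ (namely the one induced by the implicit operations ''weak inverse'' and ''weak $p$-root'', $p$ prime), and every monomorphism in $\mathsf{ICM}$ (viewed as a category with homomorphisms as arrows) is regular, i.e. is an equalizer of a parallel pair of arrows in $\mathsf{ICM}$.
   Context: Rings are unital and regarded as algebras in the language $\{+,\cdot,-,0,1\}$. $\mathsf{RCR}$ is the class of reduced commutative rings (commutative rings with no nonzero nilpotent elements); it is a quasivariety. For $n\in\mathbb{N}$, $n$ also denotes the element $1+\dots+1$ ($n$ times). A field is weakly rooted if it has characteristic $0$, or it has prime characteristic $p$ and every element $a$ has a (necessarily unique) $p$-th root $\sqrt[p]{a}$. In a field, the weak inverse of $a$ is $a^*=a^{-1}$ if $a\neq 0$ and $a^*=0$ if $a=0$. In a weakly rooted field and for a prime $p$, the weak $p$-root is $r_p(a)=\sqrt[p]{a}$ if the field has characteristic $p$ and $r_p(a)=0$ otherwise. An implicitly closed field is an algebra $\langle A;+,\cdot,-,0,1,(\,)^*,\{r_p: p \text{ prime}\}\rangle$ whose ring reduct is a weakly rooted field and where $(\,)^*$ and $r_p$ are the weak inverse and weak $p$-root. An implicitly closed meadow is an algebra in this language isomorphic to a subalgebra of a direct product of implicitly closed fields; $\mathsf{ICM}$ denotes the class of these. Let $\mathsf{K}$ be a quasivariety. An $n$-ary operation of $\mathsf{K}$ is a family $f=\langle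 f^{\mathbf A}:\mathbf A\in\mathsf K\rangle$ of partial $n$-ary functions $f^{\mathbf A}$ on $A$ such that every homomorphism $h:\mathbf A\to\mathbf B$ between members of $\mathsf K$ maps tuples in $\mathrm{dom}(f^{\mathbf A})$ into $\mathrm{dom}(f^{\mathbf B})$ and commutes with $f$. It is implicit if there is a first-order formula $\varphi(x_1,\dots,x_n,y)$ with $\mathbf A\models\varphi(\vec a,b)$ iff $\vec a\in\mathrm{dom}(f^{\mathbf A})$ and $f^{\mathbf A}(\vec a)=b$, for all $\mathbf A\in\mathsf K$; it is pp definable if $\varphi$ can be taken primitive positive (of the form $\exists\vec z$ (conjunction of equations)). It is extendable if for every $\mathbf A\in\mathsf K$ and $\vec a\in\mathrm{dom}(f^{\mathbf A})$ there is $\mathbf B\in\mathsf K$ with $\mathbf A\le\mathbf B$ and $\vec a\in\mathrm{dom}(f^{\mathbf B})$ (as stated). For a set $\mathcal F$ of pp definable extendable implicit operations, let $\mathscr L_{\mathcal F}$ add a new $n$-ary symbol for each $n$-ary $f\in\mathcal F$, and let $\mathsf K[\mathscr L_{\mathcal F}]$ be the class of expansions of those $\mathbf A\in\mathsf K$ in which every $f^{\mathbf A}$ ($f\in\mathcal F$) is total, interpreting the new symbols as the $f^{\mathbf A}$. The pp expansion of $\mathsf K$ induced by $\mathcal F$ is the class of subalgebras of members of $\mathsf K[\mathscr L_{\mathcal F}]$; it is simple if it equals $\mathsf K[\mathscr L_{\mathcal F}]$. A Beth companion of $\mathsf K$ is a pp expansion of $\mathsf K$ in which all monomorphisms are regular.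 *)

(* Defs.v *)
From mathcomp Require Import ssreflect ssrbool ssrnat prime.

Record RAlg := {
  rcar :> Type;
  radd : rcar -> rcar -> rcar;
  rmul : rcar -> rcar -> rcar;
  ropp : rcar -> rcar;
  rzero : rcar;
  rone : rcar }.

Arguments radd {r}. Arguments rmul {r}. Arguments ropp {r}.
Arguments rzero {r}. Arguments rone {r}.

Fixpoint rpow {A : RAlg} (a : A) (n : nat) : A :=
  match n with 0 => rone | S k => rmul a (rpow a k) end.

Fixpoint rnat (A : RAlg) (n : nat) : A :=
  match n with 0 => rzero | S k => radd rone (rnat A k) end.

Definition rhom (A B : RAlg) (h : A -> B) : Prop :=
  (forall x y, h (radd x y) = radd (h x) (h y)) /\
  (forall x y, h (rmul x y) = rmul (h x) (h y)) /\
  (forall x, h (ropp x) = ropp (h x)) /\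
  h rzero = rzero /\ h rone = rone.

Definition injective {X Y : Type} (f : X -> Y) : Prop :=
  forall x y, f x = f y -> x = y.

Definition comm_ring (A : RAlg) : Prop :=
  (forall x y z : A, radd x (radd y z) = radd (radd x y) z) /\
  (forall x y : A, radd x y = radd y x) /\
  (forall x : A, radd rzero x = x) /\
  (forall x : A, radd (ropp x) x = rzero) /\
  (forall x y z : A, rmul x (rmul y z) = rmul (rmul x y) z) /\
  (forall x y : A, rmul x y = rmul y x) /\
  (forall x : A, rmul rone x = x) /\
  (forall x y z : A, rmul x (radd y z) = radd (rmul x y) (rmul x z)).

Definition RCR (A : RAlg) : Prop :=
  comm_ring A /\ forall (a : A) (n : nat), rpow a n = rzero -> a = rzero.

Inductive term :=
| tVar : nat -> term
| tZero : term
| tOne : term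
| tAdd : term -> term -> term
| tMul : term -> term -> term
| tOpp : term -> term.

Fixpoint teval (A : RAlg) (v : nat -> A) (t : term) : A :=
  match t with
  | tVar n => v n
  | tZero => rzero
  | tOne => rone
  | tAdd s u => radd (teval A v s) (teval A v u)
  | tMul s u => rmul (teval A v s) (teval A v u)
  | tOpp s => ropp (teval A v s)
  end.

(* A pp formula phi(x,y) = exists z_0 z_1 ..., /\ (equations).
   Variable 0 is x, variable 1 is y, variable k+2 is the existential z_k.
   (Only finitely many variables occur in the finite list of equations.) *)
Definition ppformula := list (term * term).

Definition env {A : Type} (a b : A) (z : nat -> A) (n : nat) : A :=
  match n with 0 => a | 1 => b | S (S k) => z k end.

Fixpoint all_eqs (A : RAlg) (v : nat -> A) (phi : ppformula) : Prop :=
  match phi with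
  | nil => True
  | cons (s, t) rest => teval A v s = teval A v t /\ all_eqs A v rest
  end.

Definition ppsat (A : RAlg) (phi : ppformula) (a b : A) : Prop :=
  exists z : nat -> A, all_eqs A (env a b z) phi.

(* ---------- Unary implicit operations of a class K of RAlgs ----------
   A unary operation f of K is given by the graphs of its partial
   functions: f A a b  <->  a \in dom f^A and f^A(a) = b. *)
Definition RClass := RAlg -> Prop.
Definition UOp := forall A : RAlg, A -> A -> Prop.

Definition is_operation (K : RClass) (f : UOp) : Prop :=
  (forall A, K A -> forall a b b' : A, f A a b -> f A a b' -> b = b') /\
  (forall (A B : RAlg) (h : A -> B), K A -> K B -> rhom A B h ->
     forall a b, f A a b -> f B (h a) (h b)).

Definition pp_definable (K : RClass) (f : UOp) : Prop :=
  exists phi : ppformula, forall A, K A -> forall a b : A, f A a b <-> ppsat A phi a b.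

(* extendable: every element of every A in K lies in the domain of f^B for
   some extension A <= B in K (A <= B rendered as an embedding). *)
Definition extendable (K : RClass) (f : UOp) : Prop :=
  forall A, K A -> forall a : A,
    exists (B : RAlg) (h : A -> B), K B /\ rhom A B h /\ injective h /\
      exists b, f B (h a) b.

Definition ppdef_ext_op (K : RClass) (f : UOp) : Prop :=
  is_operation K f /\ pp_definable K f /\ extendable K f.

Definition winv_op : UOp := fun A a b =>
  rmul (rmul a b) a = a /\ rmul (rmul b a) b = b.

Definition wroot_op (p : nat) : UOp := fun A a b =>
  exists c : A,
    rmul (rmul (rnat A p) c) (rnat A p) = rnat A p /\
    rmul (rmul c (rnat A p)) c = c /\
    rmul (rnat A p) b = rzero /\
    rpow b p = rmul a (radd rone (ropp (rmul (rnat A p) c))).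

Definition primeT := {p : nat | prime p}.

Record IAlg := {
  icar :> Type;
  iadd : icar -> icar -> icar;
  imul : icar -> icar -> icar;
  iopp : icar -> icar;
  izero : icar;
  ione : icar;
  iinv : icar -> icar;
  iroot : primeT -> icar -> icar  (* r_p, p prime *) }.

Definition reduct (C : IAlg) : RAlg :=
  {| rcar := icar C; radd := iadd C; rmul := imul C; ropp := iopp C;
     rzero := izero C; rone := ione C |}.

Definition ihom (A B : IAlg) (h : A -> B) : Prop :=
  rhom (reduct A) (reduct B) h /\
  (forall x, h (iinv A x) = iinv B (h x)) /\
  (forall p x, h (iroot A p x) = iroot B p (h x)).

Definition IClass := IAlg -> Prop.

Definition iprod (I : Type) (F : I -> IAlg) : IAlg :=
  {| icar := forall i, F i;
     iadd := fun x y i => iadd (F i) (x i) (y i);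
     imul := fun x y i => imul (F i) (x i) (y i);
     iopp := fun x i => iopp (F i) (x i);
     izero := fun i => izero (F i);
     ione := fun i => ione (F i);
     iinv := fun x i => iinv (F i) (x i);
     iroot := fun p x i => iroot (F i) p (x i) |}.

Definition is_field (A : RAlg) : Prop :=
  comm_ring A /\ (rzero : A) <> rone /\
  forall a : A, a <> rzero -> exists b, rmul a b = rone.

Definition char0 (A : RAlg) : Prop := forall n, 0 < n -> rnat A n <> rzero.

Definition weakly_rooted (A : RAlg) : Prop :=
  is_field A /\
  (char0 A \/
   exists p, prime p /\ rnat A p = rzero /\ forall a : A, exists b, rpow b p = a).

Definition ICF (C : IAlg) : Prop :=
  let A := reduct C in
  weakly_rooted A /\
  iinv C (izero C) = izero C /\
  (forall a : C, a <> izero C -> imul C a (iinv C a) = ione C) /\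
  (forall (p : primeT) (a : C),
     (rnat A (proj1_sig p) = rzero -> rpow (A := A) (iroot C p a) (proj1_sig p) = a) /\
     (rnat A (proj1_sig p) <> rzero -> iroot C p a = izero C)).

Definition ICM (C : IAlg) : Prop :=
  exists (I : Type) (F : I -> IAlg) (h : C -> iprod I F),
    (forall i, ICF (F i)) /\ ihom C (iprod I F) h /\ injective h.

Definition RCR_F (C : IAlg) : Prop :=
  RCR (reduct C) /\
  (forall a : C, winv_op (reduct C) a (iinv C a)) /\
  (forall (p : primeT) (a : C), wroot_op (proj1_sig p) (reduct C) a (iroot C p a)).

Definition SClass (K : IClass) (C : IAlg) : Prop :=
  exists (B : IAlg) (h : C -> B), K B /\ ihom C B h /\ injective h.

Definition mono_in (K : IClass) (A B : IAlg) (m : A -> B) : Prop :=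
  forall (C : IAlg) (g1 g2 : C -> A), K C -> ihom C A g1 -> ihom C A g2 ->
    (forall x, m (g1 x) = m (g2 x)) -> forall x, g1 x = g2 x.

Definition regular_in (K : IClass) (A B : IAlg) (m : A -> B) : Prop :=
  exists (D : IAlg) (g1 g2 : B -> D),
    K D /\ ihom B D g1 /\ ihom B D g2 /\
    (forall x, g1 (m x) = g2 (m x)) /\
    forall (C : IAlg) (k : C -> B), K C -> ihom C B k ->
      (forall x, g1 (k x) = g2 (k x)) ->
      (exists u : C -> A, ihom C A u /\ forall x, m (u x) = k x) /\
      (forall u u' : C -> A, ihom C A u -> ihom C A u' ->
         (forall x, m (u x) = k x) -> (forall x, m (u' x) = k x) ->
         forall x, u x = u' x).

(* Main.v *)
(** Both operations are unique where defined and preserved by ring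
    homomorphisms, so a ring homomorphism between members of RCR_F is a
    homomorphism, and everything reduces to the fact that a non-nilpotent
    element of a commutative ring survives in some perfect field.

    For regularity let A <= B in ICM and b in B outside A. Localizing at a
    maximal ideal of A containing {a | a b in A} replaces A by a perfect field k
    and B by a reduced k-algebra R with b outside k. Then b (x) 1 - 1 (x) b is
    not nilpotent in the tensor square of R over k, so it survives in a perfect
    field, which receives two maps from B that agree on A and differ at b. *)
From HB Require Import structures.
From mathcomp Require Import all_boot all_algebra.
From mathcomp Require Import boolp classical_sets.
From mathcomp Require Import ring.
Require Import Defs.
Set Implicit Arguments.
Unset Strict Implicit.
Unset Printing Implicit Defensive.
Import GRing.Theory.
Local Open Scope ring_scope.

(** * Quotients and maximal submodules *)

(** Weak inverses make the members of ICM von Neumann regular. Hence the localization of A at a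
    maximal ideal is a field that is already a quotient of A, and R, a quotient of the regular ring
    B, is reduced. Weak p-roots make k perfect, and separation depends on this: if k had
    characteristic p and b outside k had b^p in k, then (b (x) 1 - 1 (x) b)^p = 0, and two maps to a
    field that agree on k would agree at b.

    It is not enough that b (x) 1 - 1 (x) b is nonzero, since maps to fields kill nilpotents. If it
    is nilpotent, then in characteristic p some b^(p^n) lies in k, and in characteristic 0 a monic
    polynomial over k becomes a power of X - b; either way b is recovered inside k. R may have any
    dimension over k, so the linear algebra uses functionals obtained from Zorn's lemma instead of
    bases. *)

Record ring_congruence (X : Type) (add mul : X -> X -> X) (opp : X -> X)
    (zero one : X) (e : X -> X -> Prop) : Prop := RingCongruence {
  cong_refl : forall x, e x x;
  cong_sym : forall x y, e x y -> e y x;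
  cong_trans : forall x y z, e x y -> e y z -> e x z;
  cong_add : forall x x' y y', e x x' -> e y y' -> e (add x y) (add x' y');
  cong_mul : forall x x' y y', e x x' -> e y y' -> e (mul x y) (mul x' y');
  cong_opp : forall x x', e x x' -> e (opp x) (opp x');
  cong_addA : forall x y z, e (add x (add y z)) (add (add x y) z);
  cong_addC : forall x y, e (add x y) (add y x);
  cong_add0 : forall x, e (add zero x) x;
  cong_addN : forall x, e (add (opp x) x) zero;
  cong_mulA : forall x y z, e (mul x (mul y z)) (mul (mul x y) z);
  cong_mulC : forall x y, e (mul x y) (mul y x);
  cong_mul1 : forall x, e (mul one x) x;
  cong_mulDl : forall x y z, e (mul (add x y) z) (add (mul x z) (mul y z)) }.

Section QuotientRing.
Local Open Scope quotient_scope.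

(** The axioms are required only modulo [e] because lists under concatenation, used for the tensor
    square, form no ring before the quotient is taken. The quotient may be the zero ring, hence
    [comPzRingType]. *)
Lemma quotient_ring (X : choiceType) (add mul : X -> X -> X) (opp : X -> X)
    (zero one : X) (e : X -> X -> Prop) :
  ring_congruence add mul opp zero one e ->
  exists (Q : comPzRingType) (q : X -> Q),
    [/\ forall z, exists x, q x = z,
        forall x y, q x = q y <-> e x y,
        forall x y, q (add x y) = q x + q y,
        forall x y, q (mul x y) = q x * q y &
        [/\ forall x, q (opp x) = - q x, q zero = 0 & q one = 1]].
Proof.
case=> eR eS eT cD cM cN DA DC D0 DN MA MC M1 MD.
have er : reflexive (fun x y => `[< e x y >]) by move=> x; apply/asboolP.
have es : symmetric (fun x y => `[< e x y >]).
  by move=> x y; apply/asboolP/asboolP; apply: eS.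
have et : transitive (fun x y => `[< e x y >]).
  by move=> y x z /asboolP exy /asboolP eyz; apply/asboolP; apply: eT eyz.
pose E := EquivRel _ er es et.
pose T := {eq_quot E}.
pose q : X -> T := \pi_T.
have qE x y : q x = q y <-> e x y.
  by split=> [/eqmodP/asboolP | exy] //; apply/eqmodP/asboolP.
have qr x : e (repr (q x)) x by apply/qE; rewrite /q reprK.
have qs z : exists x, q x = z by exists (repr z); rewrite /q reprK.
pose ad (x y : T) := q (add (repr x) (repr y)).
pose mu (x y : T) := q (mul (repr x) (repr y)).
pose op (x : T) := q (opp (repr x)).
have adE x y : q (add x y) = ad (q x) (q y).
  by apply/qE/eS/cD; apply: qr.
have muE x y : q (mul x y) = mu (q x) (q y).
  by apply/qE/eS/cM; apply: qr.
have opE x : q (opp x) = op (q x) by apply/qE/eS/cN; apply: qr.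
have adA : associative ad.
  move=> x y z; have [[[x' <-] [y' <-]] [z' <-]] := (qs x, qs y, qs z).
  by rewrite -!adE; apply/qE.
have adC : commutative ad.
  by move=> x y; have [[x' <-] [y' <-]] := (qs x, qs y); rewrite -!adE; apply/qE.
have ad0 : left_id (q zero) ad.
  by move=> x; have [x' <-] := qs x; rewrite -!adE; apply/qE.
have adN : left_inverse (q zero) op ad.
  by move=> x; have [x' <-] := qs x; rewrite -opE -adE; apply/qE.
have muA : associative mu.
  move=> x y z; have [[[x' <-] [y' <-]] [z' <-]] := (qs x, qs y, qs z).
  by rewrite -!muE; apply/qE.
have muC : commutative mu.
  by move=> x y; have [[x' <-] [y' <-]] := (qs x, qs y); rewrite -!muE; apply/qE.
have mu1 : left_id (q one) mu.
  by move=> x; have [x' <-] := qs x; rewrite -!muE; apply/qE.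
have muD : left_distributive mu ad.
  move=> x y z; have [[[x' <-] [y' <-]] [z' <-]] := (qs x, qs y, qs z).
  by rewrite -!(muE, adE); apply/qE.
pose zm := GRing.isZmodule.Build T adA adC ad0 adN.
pose TZ : zmodType := HB.pack T zm.
pose rm := GRing.Zmodule_isComPzRing.Build TZ muA muC mu1 muD.
pose TR : comPzRingType := HB.pack T zm rm.
by exists TR, q.
Qed.

End QuotientRing.

Definition scalars (R : comPzRingType) (k : R -> Prop) : Prop :=
  [/\ k 1, forall x y, k x -> k y -> k (x + y),
      forall x y, k x -> k y -> k (x * y) & forall x, k x -> k (- x)].

Definition submodule (R : comPzRingType) (k W : R -> Prop) : Prop :=
  [/\ W 0, forall x y, W x -> W y -> W (x + y) &
      forall c x, k c -> W x -> W (c * x)].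

(** Serves twice: with all of R as scalars and v = 1 it yields maximal ideals; with a subfield as
    scalars it yields a hyperplane missing v, the kernel of a functional. *)
Lemma max_submodule (R : comPzRingType) (k W : R -> Prop) (v : R) :
  scalars k -> submodule k W -> ~ W v ->
  exists M : R -> Prop,
    [/\ submodule k M, forall x, W x -> M x, ~ M v &
        forall y, ~ M y -> exists c w, [/\ k c, M w & v = w + c * y]].
Proof.
move=> [k1 kD kM kN] [W0 WD WM] Wv.
have k0 : k 0 by rewrite -(addNr 1); apply: kD => //; apply: kN.
(* Zorn_bigcup also asks about the empty chain, hence the enlargement by W *)
pose P (X : set R) := submodule k (fun x => W x \/ X x) /\ ~ (W v \/ X v).
have chainP (F : set (set R)) : (F `<=` P)%classic -> total_on F subset ->
    P (\bigcup_(X in F) X)%classic.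
  move=> FP totF; split; last first.
    by case=> // -[X FX Xv]; have [_] := FP _ FX; apply; right.
  have push X x : F X -> W x \/ X x -> W x \/ (\bigcup_(Z in F) Z)%classic x.
    by move=> FX [Wx|Xx]; [left|right; exists X].
  split; first by left.
  - move=> x y [Wx|[X FX Xx]] [Wy|[Y FY Yy]]; first by left; apply: WD.
    + by have [[_ YD _] _] := FP _ FY; apply: (push Y) => //; apply: YD; auto.
    + by have [[_ XD _] _] := FP _ FX; apply: (push X) => //; apply: XD; auto.
    + have [Z FZ [Zx Zy]] : exists2 Z, F Z & Z x /\ Z y.
        by case: (totF _ _ FX FY) => s; [exists Y|exists X]; auto.
      by have [[_ ZD _] _] := FP _ FZ; apply: (push Z) => //; apply: ZD; auto.
  - move=> c x kc [Wx|[X FX Xx]]; first by left; apply: WM.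
    by have [[_ _ XM] _] := FP _ FX; apply: (push X) => //; apply: XM; auto.
have [M [[[M0 MD MM] Mv] maxM]] := Zorn_bigcup chainP.
exists (fun x => W x \/ M x); split=> // [|y My]; first by left.
(* This is M + k y; if it missed v, it would properly extend the maximal M. *)
pose N x := exists c w, [/\ k c, W w \/ M w & x = w + c * y].
have MN x : W x \/ M x -> N x.
  by move=> Mx; exists 0, x; rewrite mul0r addr0.
have NW x : W x \/ N x -> N x by case=> // Wx; apply: MN; left.
apply: contrapT => Nv; apply: (maxM N).
  split=> [x Mx | /(_ y) NM]; first by apply: MN; right.
  by apply: My; right; apply: NM; exists 1, 0; rewrite mul1r add0r.
split; last by move=> /NW.
split; first by left.
- move=> _ _ /NW[c [w [kc Mw ->]]] /NW[d [z [kd Mz ->]]]; right.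
  by exists (c + d), (w + z); split; [exact: kD|exact: MD|ring].
- move=> a _ ka /NW[c [w [kc Mw ->]]]; right.
  by exists (a * c), (a * w); split; [exact: kM|exact: MM|ring].
Qed.

(** * Maps to perfect fields *)

Definition mk_rmorphism (R S : pzRingType) (f : R -> S)
    (fB : zmod_morphism f) (fX : monoid_morphism f) : {rmorphism R -> S} :=
  HB.pack f (GRing.isZmodMorphism.Build R S f fB)
            (GRing.isMonoidMorphism.Build R S f fX).

Definition ideal (R : comPzRingType) (I : R -> Prop) : Prop :=
  submodule (fun _ => True) I.

Lemma quotient_ideal (R : comPzRingType) (I : R -> Prop) :
  ideal I ->
  exists (Q : comPzRingType) (q : {rmorphism R -> Q}),
    (forall z, exists x, q x = z) /\ (forall x, q x = 0 <-> I x).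
Proof.
move=> [I0 ID IM].
have IN x : I x -> I (- x) by rewrite -mulN1r; apply: IM.
have [] := @quotient_ring R +%R *%R -%R 0 1 (fun x y => I (x - y)).
  split=> [x|x y|x y z|x x' y y'|x x' y y'|x x'|x y z|x y|x|x|x y z|x y|x|x y z];
    rewrite ?(addrA, mulrA, mul1r, add0r, addNr, mulrDl) ?(subrr, oppr0) //.
  - by move=> Ixy; rewrite -opprB; apply: IN.
  - by move=> Ixy Iyz; rewrite (_ : x - z = (x - y) + (y - z)); [exact: ID|ring].
  - move=> Ix Iy; rewrite (_ : _ - _ = (x - x') + (y - y')); first exact: ID.
    ring.
  - move=> Ix Iy; rewrite (_ : _ - _ = y * (x - x') + x' * (y - y')); last by ring.
    by apply: ID; apply: IM.
  - by move=> Ix; rewrite -opprD; apply: IN.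
  - by rewrite (addrC y) subrr.
  - by rewrite (mulrC x) subrr.
move=> Q [q [qs qE qD qM [qN q0 q1]]].
have qB : zmod_morphism q by move=> x y; rewrite qD qN.
have qX : monoid_morphism q by split.
exists Q, (mk_rmorphism qB qX); split=> // x.
have /= := qE x 0.
by rewrite q0 subr0.
Qed.

Lemma comPzRing_field (R : comPzRingType) :
  (1 : R) <> 0 -> (forall x : R, x <> 0 -> exists y, x * y = 1) ->
  exists (K : fieldType) (f : {rmorphism R -> K}),
    (forall z, exists x, f x = z) /\ (forall x y, f x = f y -> x = y).
Proof.
move=> n10 invR.
pose inv (x : R) := if pselect (exists y, x * y = 1) is left e
                    then projT1 (cid e) else 0.
have mulV x : x != 0 -> inv x * x = 1.
  move=> /eqP /invR ex; rewrite /inv; case: pselect => // e.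
  by case: cid => /= y; rewrite mulrC.
have inv0 : inv 0 = 0.
  rewrite /inv; case: pselect => // e.
  by exfalso; case: e => y; rewrite mul0r => /esym/n10.
have /eqP n1 := n10.
pose nz := GRing.PzSemiRing_isNonZero.Build R n1.
pose NR : comNzRingType := HB.pack R nz.
pose fm := GRing.ComNzRing_isField.Build NR mulV inv0.
pose K : fieldType := HB.pack R nz fm.
have qB : zmod_morphism (id : R -> K) by [].
have qX : monoid_morphism (id : R -> K) by [].
by exists K, (mk_rmorphism qB qX); split=> // z; exists z.
Qed.

Lemma residue_field (R : comPzRingType) (I : R -> Prop) :
  ideal I -> ~ I 1 ->
  exists (K : fieldType) (f : {rmorphism R -> K}), forall x, I x -> f x = 0.
Proof.
move=> idI I1.
have [//|M [idM IM M1 maxM]] := @max_submodule R (fun _ => True) I 1 _ idI I1.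
have [Q [q [qs q0]]] := quotient_ideal idM.
have [| |K [f _]] := @comPzRing_field Q.
- by rewrite -(rmorph1 q) q0.
- move=> z; have [x <-] := qs z; rewrite q0 => /maxM[c [w [_ Mw ex]]].
  exists (q c); rewrite -(rmorph1 q) ex rmorphD rmorphM mulrC.
  by have /q0 -> := Mw; rewrite add0r.
by exists K, (f \o q) => x /IM/q0 /= ->; rewrite rmorph0.
Qed.

(* The perfect closure is the direct limit of K along Frobenius: [x] in the
   limit is given by the germ at infinity of i |-> x^(p^i). *)
Lemma perfect_closure (K : fieldType) (p : nat) :
  p \in [pchar K] ->
  exists (L : fieldType) (f : {rmorphism K -> L}),
    forall a : L, exists b, b ^+ p = a.
Proof.
move=> pK.
have p0 : (0 < p)%N by have /andP[/prime_gt0] := pK.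
have frobD (x y : K) : (x + y) ^+ p = x ^+ p + y ^+ p.
  by rewrite -!(pFrobenius_autE pK) rmorphD.
have frobN (x : K) : (- x) ^+ p = - x ^+ p.
  by rewrite -!(pFrobenius_autE pK) rmorphN.
pose compat (x : nat -> K) := exists n, forall i, (n <= i)%N -> x i.+1 = x i ^+ p.
pose S : choiceType := {x : nat -> K | `[< compat x >]}.
pose mk x (cx : compat x) : S := exist _ x (asboolT cx).
have cS (x : S) : compat (sval x) by case: x => /= x /asboolP.
have cD (x y : S) : compat (fun i => sval x i + sval y i).
  have [[m xm] [n yn]] := (cS x, cS y); exists (maxn m n) => i.
  by rewrite geq_max => /andP[/xm-> /yn->]; rewrite frobD.
have cM (x y : S) : compat (fun i => sval x i * sval y i).
  have [[m xm] [n yn]] := (cS x, cS y); exists (maxn m n) => i.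
  by rewrite geq_max => /andP[/xm-> /yn->]; rewrite exprMn.
have cN (x : S) : compat (fun i => - sval x i).
  by have [m xm] := cS x; exists m => i /xm->; rewrite frobN.
have cK (a : K) : compat (fun i => a ^+ (p ^ i)%N).
  by exists 0%N => i _; rewrite -exprM expnSr.
have cV (x : S) : compat (fun i => (sval x i)^-1).
  by have [m xm] := cS x; exists m => i /xm->; rewrite exprVn.
(* Delaying a germ by one index extracts its p-th root, since x_(i-1)^p = x_i for large i. *)
have cR (x : S) : compat (fun i => sval x i.-1).
  have [m xm] := cS x; exists m.+1 => -[//|i] /=; exact: xm.
have c0 : compat (fun=> 0) by exists 0%N => i _; rewrite expr0n eqn0Ngt p0.
have c1 : compat (fun=> 1) by exists 0%N => i _; rewrite expr1n.
pose e (x y : S) := exists n, forall i, (n <= i)%N -> sval x i = sval y i.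
have ept (x y : S) : sval x =1 sval y -> e x y by exists 0%N => i _.
have [|Q [q [qs qE qD qM [qN q0 q1]]]] := @quotient_ring S
    (fun x y => mk _ (cD x y)) (fun x y => mk _ (cM x y)) (fun x => mk _ (cN x))
    (mk _ c0) (mk _ c1) e.
  split=> [x|x y|x y z|x x' y y'|x x' y y'|x x'|x y z|x y|x|x|x y z|x y|x|x y z];
    try by apply: ept => i /=; ring.
  - by move=> [n h]; exists n => i /h.
  - move=> [m h] [n h']; exists (maxn m n) => i.
    by rewrite geq_max => /andP[/h-> /h'->].
  - move=> [m h] [n h']; exists (maxn m n) => i.
    by rewrite geq_max => /andP[/= /h-> /h'->].
  - move=> [m h] [n h']; exists (maxn m n) => i.
    by rewrite geq_max => /andP[/= /h-> /h'->].
  - by move=> [m h]; exists m => i /= /h->.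
have [| |L [f [fs fi]]] := @comPzRing_field Q.
- by rewrite -q0 -q1 => /qE[n /(_ n (leqnn n))/= /eqP]; rewrite oner_eq0.
- move=> z; have [x <-] := qs z => x0; exists (q (mk _ (cV x))).
  rewrite -qM -q1; apply/qE; have [n xn] := cS x.
  (* Past [n] a single zero value makes all later values zero. A nonzero germ therefore has no zero
     past [n] and is inverted pointwise. *)
  exists n => i ni /=; apply: divff; apply/eqP => xi0; apply: x0.
  rewrite -q0; apply/qE; exists i => j /subnK <-.
  elim: (j - i)%N => [//|k IH]; rewrite addSn xn; last first.
    by apply: leq_trans ni _; apply: leq_addl.
  by rewrite IH /= expr0n eqn0Ngt p0.
have eQ (x : S) n : exists y : S, q x ^+ n = q y /\ forall i, sval y i = sval x i ^+ n.
  elim: n => [|n [y [IH Ey]]]; first by exists (mk _ c1).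
  exists (mk _ (cM x y)); rewrite exprS IH qM; split=> // i.
  by rewrite exprS -Ey.
pose g a := f (q (mk _ (cK a))).
have gB : zmod_morphism g.
  move=> a b; rewrite /g (_ : q _ = q (mk _ (cK a)) - q (mk _ (cK b))) ?rmorphB //.
  rewrite -qN -qD; apply/qE; apply: ept => i /=.
  elim: i => [|i IH]; rewrite ?expn0 ?expr1 // !expnSr !exprM IH.
  by rewrite frobD frobN.
have gX : monoid_morphism g.
  split.
    rewrite /g (_ : q _ = 1) ?rmorph1 // -q1; apply/qE; apply: ept => i /=.
    by rewrite expr1n.
  move=> a b; rewrite /g (_ : q _ = q (mk _ (cK a)) * q (mk _ (cK b))) ?rmorphM //.
  by rewrite -qM; apply/qE; apply: ept => i /=; rewrite exprMn.
exists L, (mk_rmorphism gB gX) => a.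
have [z <-] := fs a; have [x <-] := qs z.
exists (f (q (mk _ (cR x)))); rewrite -rmorphXn; apply: (congr1 f).
have [y [-> Ey]] := eQ (mk _ (cR x)) p; apply/qE.
have [n xn] := cS x; exists n.+1 => -[//|i] /xn; rewrite Ey => ->.
by [].
Qed.

Definition perfect (K : fieldType) : Prop :=
  forall p, p \in [pchar K] -> forall a : K, exists b, b ^+ p = a.

Lemma perfect_extension (K : fieldType) :
  exists (L : fieldType) (f : {rmorphism K -> L}), perfect L.
Proof.
have [[p pK]|ch0] := pselect (exists p, p \in [pchar K]).
  have [L [f rootL]] := perfect_closure pK; exists L, f => r rL.
  have pL : p \in [pchar L] by rewrite (fmorph_pchar f).
  by move: rL; rewrite (pcharf_eq pL) inE => /eqP->.
by exists K, idfun => p pK; case: ch0; exists p.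
Qed.

(* A prime of R avoiding a is obtained as the kernel of R -> R[X]/M, where M is
   a maximal ideal containing a X - 1. *)
Lemma perfect_field_sep (R : comPzRingType) (a : R) :
  (forall n, a ^+ n <> 0) ->
  exists (K : fieldType) (f : {rmorphism R -> K}), perfect K /\ f a <> 0.
Proof.
move=> nila.
have /eqP n1 : (1 : R) <> 0 by apply: nila 0%N.
pose nz := GRing.PzSemiRing_isNonZero.Build R n1.
pose S : comNzRingType := HB.pack R nz.
pose u : {poly S} := (a : S)%:P * 'X - 1.
have [||K [f fu]] := @residue_field {poly S} (fun P => exists g, P = u * g).
- split=> [|_ _ [g ->] [h ->]|c _ _ [g ->]]; first by exists 0; rewrite mulr0.
    by exists (g + h); rewrite mulrDr.
  by exists (c * g); rewrite mulrCA.
- move=> [g /esym ug1].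
  (* From (a X - 1) g = 1, g has the coefficients of the power series -1/(1 - a X); as g is a
     polynomial, some power of a vanishes. *)
  have coefg i : g`_i = - (a : S) ^+ i.
    have /polyP ug := ug1; elim: i => [|i IH].
      have := ug 0%N; rewrite mulrBl mul1r -mulrA coefB coefCM coefXM coef1 /=.
      by rewrite mulr0 add0r => /eqP; rewrite eqr_oppLR => /eqP.
    have := ug i.+1; rewrite mulrBl mul1r -mulrA coefB coefCM coefXM coef1 /=.
    by move/eqP; rewrite subr_eq0 IH mulrN -exprS => /eqP.
  apply: (nila (size g)); apply/eqP; rewrite -oppr_eq0; apply/eqP.
  by rewrite -[LHS](coefg (size g)) nth_default.
have [L [h perfL]] := perfect_extension K.
have hC : zmod_morphism (fun x : R => h (f (x : S)%:P)).
  by move=> x y; rewrite -!rmorphB.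
have hM : monoid_morphism (fun x : R => h (f (x : S)%:P)).
  by split=> [|x y]; rewrite -?rmorphM ?rmorph1.
exists L, (mk_rmorphism hC hM); split=> //= /eqP.
rewrite fmorph_eq0 => /eqP fa0.
(* [f] kills a X - 1, so f(a) = 0 would give 1 = 0. *)
have := fu u; rewrite rmorphB rmorphM fa0 mul0r rmorph1 sub0r => /(_ _)/eqP.
by rewrite oppr_eq0 oner_eq0 => /(_ _)/notF; apply; exists 1; rewrite mulr1.
Qed.

(** * Amalgamation over a perfect field *)

Definition subfield (R : comPzRingType) (k : R -> Prop) : Prop :=
  scalars k /\ forall x, k x -> x <> 0 -> exists2 y, k y & x * y = 1.

(** Values are taken in R and not in [k], so that the identity is an instance. *)
Definition klinear (R : comPzRingType) (k : R -> Prop) (phi : R -> R) : Prop :=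
  (forall x y, phi (x + y) = phi x + phi y) /\
  (forall c x, k c -> phi (c * x) = c * phi x).

(** If M is maximal among the submodules that contain W and miss v, then R is the direct sum of M
    and k v, because k is a field; [phi] is the coordinate along v. *)
Lemma separating_functional (R : comPzRingType) (k W : R -> Prop) (v : R) :
  subfield k -> submodule k W -> ~ W v ->
  exists phi, [/\ klinear k phi, forall x, W x -> phi x = 0 & phi v = 1].
Proof.
move=> [sk invk] sW Wv; have [M [[M0 MD MM] WM Mv maxM]] := max_submodule sk sW Wv.
have [k1 kD kM kN] := sk.
have MB x y : M x -> M y -> M (x - y).
  by move=> Mx My; apply: MD => //; rewrite -mulN1r; apply: MM => //; apply: kN.
have coordP y : exists c, k c /\ M (y - c * v).
  have [My|/maxM[c [w [kc Mw ev]]]] := pselect (M y).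
    exists (1 - 1); split; first by apply: kD => //; apply: kN.
    by rewrite subrr mul0r subr0.
  have [|d kd cd] := invk c kc.
    by move=> c0; apply: Mv; rewrite ev c0 mul0r addr0.
  exists d; split=> //.
  rewrite ev (_ : _ - _ = (1 - c * d) * y - d * w); last by ring.
  by rewrite cd subrr mul0r; apply: MB => //; apply: MM.
have coord_uniq y c d : k c -> k d -> M (y - c * v) -> M (y - d * v) -> c = d.
  move=> kc kd Mc Md; apply: contrapT => ncd.
  have kcd : k (c - d) by apply: kD => //; apply: kN.
  have [|z kz cdz] := invk _ kcd; first by move/eqP; rewrite subr_eq0 => /eqP.
  apply: Mv; rewrite -[v]mul1r -cdz.
  have -> : (c - d) * z * v = z * ((y - d * v) - (y - c * v)) by ring.
  by apply: MM => //; apply: MB.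
pose phi y := projT1 (cid (coordP y)).
have phiP y : k (phi y) /\ M (y - phi y * v) by rewrite /phi; case: cid.
have phiE y c : k c -> M (y - c * v) -> phi y = c.
  by move=> kc Mc; have [kp Mp] := phiP y; apply: coord_uniq Mp Mc.
have k0 : k 0 by rewrite -(subrr 1); apply: kD => //; apply: kN.
exists phi; split; first split.
- move=> x y; have [[kx Mx] [ky My]] := (phiP x, phiP y).
  by apply: phiE; [exact: kD|rewrite mulrDl opprD addrACA; exact: MD].
- move=> c x kc; have [kx Mx] := phiP x.
  by apply: phiE; [exact: kM|rewrite -mulrA -mulrBr; exact: MM].
- by move=> x Wx; apply: phiE => //; rewrite mul0r subr0; apply: WM.
- by apply: phiE => //; rewrite mul1r subrr.
Qed.

(* T is the tensor square of R over k: a formal sum of pure tensors x (x) y is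
   identified with the functional phi |-> sum x phi(y) on k-linear maps R -> R;
   g1 x = x (x) 1 and g2 y = 1 (x) y. *)
Lemma tensor_square (R : comNzRingType) (k : R -> Prop) :
  exists (T : comNzRingType) (g1 g2 : {rmorphism R -> T})
         (ev : T -> (R -> R) -> R),
    (forall c, k c -> g1 c = g2 c) /\
    forall phi, klinear k phi ->
      (forall s t, ev (s + t) phi = ev s phi + ev t phi) /\
      (forall x y, ev (g1 x * g2 y) phi = x * phi y).
Proof.
pose X : choiceType := seq (R * R).
pose ev (l : X) (phi : R -> R) := \sum_(a <- l) a.1 * phi a.2.
pose mul (l m : X) : X := [seq (a.1 * b.1, a.2 * b.2) | a <- l, b <- m].
pose opp (l : X) : X := [seq (- a.1, a.2) | a <- l].
pose e l m := forall phi, klinear k phi -> ev l phi = ev m phi.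
have evD l m phi : ev (l ++ m) phi = ev l phi + ev m phi by rewrite /ev big_cat.
have evN l phi : ev (opp l) phi = - ev l phi.
  by rewrite /ev big_map -sumrN; apply: eq_bigr => a _; rewrite mulNr.
have evM l m phi :
    ev (mul l m) phi = \sum_(a <- l) \sum_(b <- m) a.1 * b.1 * phi (a.2 * b.2).
  by rewrite /ev big_allpairs_dep.
have evMl l m phi :
    ev (mul l m) phi = \sum_(a <- l) a.1 * ev m (fun y => phi (a.2 * y)).
  rewrite evM; apply: eq_bigr => a _; rewrite mulr_sumr.
  by apply: eq_bigr => b _; rewrite mulrA.
have evC l m phi : ev (mul l m) phi = ev (mul m l) phi.
  rewrite !evM exchange_big; apply: eq_bigr => a _; apply: eq_bigr => b _.
  by rewrite mulrC [a.2 * _]mulrC [a.1 * _]mulrC mulrC.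
(* Functionals are stable under precomposition with a multiplication, so the product respects [e] in
   its second argument; [evC] transfers this to the first. *)
have linM phi a : klinear k phi -> klinear k (fun y => phi (a * y)).
  move=> [fD fM]; split=> [x y|c x kc]; first by rewrite mulrDr fD.
  by rewrite mulrCA (fM c).
have eM l m m' : e m m' -> e (mul l m) (mul l m').
  move=> emm phi lphi; rewrite !evMl; apply: eq_bigr => a _; congr (_ * _).
  exact/emm/linM.
have [|T0 [q [qs qE qD qM [qN q0 q1]]]] :=
  @quotient_ring X cat mul opp [::] [:: (1, 1)] e.
  split=> [x|x y|x y z|x x' y y'|x x' y y'|x x'|x y z|x y|x|x|x y z|x y|x|x y z].
  - by [].
  - by move=> exy phi /exy.
  - by move=> exy eyz phi lphi; rewrite exy // eyz.
  - by move=> ex ey phi lphi; rewrite !evD ex // ey.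
  - move=> ex ey phi lphi; rewrite (eM _ _ _ ey) // evC (eM _ _ _ ex) //.
  - by move=> ex phi lphi; rewrite !evN ex.
  - by move=> phi _; rewrite catA.
  - by move=> phi _; rewrite !evD addrC.
  - by move=> phi _.
  - by move=> phi _; rewrite evD evN addNr /ev big_nil.
  - move=> phi _; rewrite !evMl /mul big_allpairs_dep; apply: eq_bigr => a _ /=.
    rewrite evMl mulr_sumr; apply: eq_bigr => b _; rewrite mulrA.
    by congr (_ * _); apply: eq_bigr => c _; rewrite mulrA.
  - by move=> phi _; rewrite evC.
  - move=> phi _; rewrite evM big_seq1 /=.
    by apply: eq_bigr => a _; rewrite !mul1r.
  - by move=> phi _; rewrite evD !evMl big_cat.
have ev1 x y phi : ev [:: (x, y)] phi = x * phi y by rewrite /ev big_seq1.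
have /eqP n1 : (1 : T0) <> 0.
  (* The identity functional distinguishes 1 (x) 1 from 0. *)
  have lid : klinear k id by split.
  rewrite -q0 -q1 => /qE /(_ id lid).
  by rewrite ev1 /ev big_nil mulr1 => /eqP; rewrite oner_eq0.
pose nz := GRing.PzSemiRing_isNonZero.Build T0 n1.
pose T : comNzRingType := HB.pack T0 nz.
pose g1 x : T := q [:: (x, 1)]; pose g2 y : T := q [:: (1, y)].
have g1B : zmod_morphism g1.
  by move=> x y; rewrite -qN -qD; apply/qE => phi _; rewrite evD evN !ev1 mulrBl.
have g1M : monoid_morphism g1.
  by split=> // x y; rewrite -qM; apply/qE => phi _; rewrite /mul /= !ev1 mul1r.
have g2B : zmod_morphism g2.
  move=> x y; rewrite -qN -qD; apply/qE => phi [fD _]; rewrite evD evN !ev1.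
  by rewrite !mul1r; apply/eqP; rewrite eq_sym subr_eq -fD subrK.
have g2M : monoid_morphism g2.
  by split=> // x y; rewrite -qM; apply/qE => phi _; rewrite /mul /= !ev1 !mul1r.
(* A class is evaluated at a chosen representative; the choice is immaterial for k-linear [phi]. *)
pose rep t := projT1 (cid (qs t)).
have repK l : e (rep (q l)) l by apply/qE; rewrite /rep; case: cid.
exists T, (mk_rmorphism g1B g1M), (mk_rmorphism g2B g2M), (fun t => ev (rep t)).
split=> [c kc|phi lphi]; first apply/qE => phi [_ fM].
  by rewrite !ev1 mul1r -[c in RHS]mulr1 fM.
split=> [s t|x y] /=; last first.
  by rewrite -qM repK // /mul /= ev1 mulr1 mul1r.
have [[l <-] [m <-]] := (qs s, qs t).
by rewrite -qD !repK.
Qed.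

Lemma coefPn_exp_XsubC (R : comNzRingType) (c : R) (n : nat) :
  (('X - c%:P) ^+ n.+1)`_n = - (c *+ n.+1).
Proof.
have := @coefPn_prod_XsubC R (nseq n.+1 c); rewrite size_nseq => /(_ isT).
by rewrite !big_nseq iter_mulr_1 iter_addr_0.
Qed.

(** R may have zero divisors, but a prime, being nonzero in the subfield k, is invertible; a
    vanishing n can thus be divided by a prime factor, and induction applies. *)
Lemma subfield_natr_neq0 (R : comPzRingType) (k : R -> Prop) :
  subfield k -> (1 : R) <> 0 -> (forall p, prime p -> p%:R <> 0 :> R) ->
  forall n, (0 < n)%N -> n%:R <> 0 :> R.
Proof.
move=> [[k1 kD kM kN] invk] n10 ch0; elim/ltn_ind => -[//|n] IH _.
have kn m : k m%:R.
  elim: m => [|m km]; last by rewrite mulrS; apply: kD.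
  by rewrite mulr0n -(addNr 1); apply: kD => //; apply: kN.
have [->//|n1] := eqVneq n 0%N.
have pp := pdiv_prime (n := n.+1); rewrite ltnS lt0n in pp.
have dv := pdiv_dvd n.+1 => e0.
have [y _ py] := invk _ (kn (pdiv n.+1)) (ch0 _ (pp n1)).
apply: (IH (n.+1 %/ pdiv n.+1)%N).
- by apply: ltn_Pdiv => //; apply/prime_gt1/pp.
- by rewrite divn_gt0 ?pdiv_gt0 // dvdn_leq.
- by rewrite -[LHS]mulr1 -[X in _ * X = _]py mulrA -natrM divnK // e0 mul0r.
Qed.

Lemma frobenius_iterB (R : comNzRingType) (p m : nat) (x y : R) :
  prime p -> p%:R = 0 :> R ->
  (x - y) ^+ (p ^ m)%N = x ^+ (p ^ m)%N - y ^+ (p ^ m)%N.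
Proof.
move=> pp p0.
have pR : p \in [pchar R] by rewrite inE /= pp p0 eqxx.
have nR : [pchar R].-nat (p ^ m)%N.
  by rewrite pnatX pnatE ?pR.
by apply/eqP; rewrite eq_sym subr_eq -exprDn_pchar // subrK.
Qed.

Definition reduced (R : pzRingType) : Prop :=
  forall (x : R) n, x ^+ n = 0 -> x = 0.

Definition power_span (R : comPzRingType) (k : R -> Prop) (b : R) (d : nat)
    (x : R) : Prop :=
  exists c : nat -> R, (forall i, k (c i)) /\ x = \sum_(i < d) c i * b ^+ i.

Lemma power_span_submodule (R : comPzRingType) (k : R -> Prop) (b : R) (d : nat) :
  scalars k -> submodule k (power_span k b d).
Proof.
move=> [k1 kD kM kN]; have k0 : k 0 by rewrite -(addNr 1); apply: kD => //; apply: kN.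
split=> [|_ _ [c [kc ->]] [c' [kc' ->]]|a _ ka [c [kc ->]]].
- by exists (fun=> 0); split=> //; rewrite big1 // => i _; rewrite mul0r.
- exists (fun i => c i + c' i); split=> [i|]; first exact: kD.
  by rewrite -big_split; apply: eq_bigr => i _; rewrite mulrDl.
- exists (fun i => a * c i); split=> [i|]; first exact: kM.
  by rewrite mulr_sumr; apply: eq_bigr => i _; rewrite mulrA.
Qed.

(* In characteristic 0: if b (x) 1 - 1 (x) b is nilpotent, then b has a monic
   relation f over k of minimal degree d, and f divides (X - b)^n in R[X]. Hence
   f = (X - b)^d over every field to which R maps, so d b is minus the coefficient
   of f in degree d - 1, because R is reduced. *)
Lemma nilpotent_diff_char0 (R T : comNzRingType) (k : R -> Prop)
    (g1 g2 : {rmorphism R -> T}) (ev : T -> (R -> R) -> R) (b : R) (n : nat) :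
  reduced R -> subfield k -> (forall n, (0 < n)%N -> n%:R <> 0 :> R) ->
  (forall c, k c -> g1 c = g2 c) ->
  (forall phi, klinear k phi ->
     (forall s t, ev (s + t) phi = ev s phi + ev t phi) /\
     (forall x y, ev (g1 x * g2 y) phi = x * phi y)) ->
  (g1 b - g2 b) ^+ n = 0 -> k b.
Proof.
move=> redR sk ch0 g12 evP nil.
have [[k1 kD kM kN] invk] := sk.
have kn m : k m%:R.
  elim: m => [|m km]; last by rewrite mulrS; apply: kD.
  by rewrite mulr0n -(addNr 1); apply: kD => //; apply: kN.
have cg : commr_rmorph g1 (g2 b) by move=> x; rewrite /GRing.comm mulrC.
(* [th] is g1 on coefficients and sends X to g2 b, so X - b goes to minus the nilpotent element. *)
pose th : {rmorphism {poly R} -> T} := horner_morph cg.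
have thE (P : {poly R}) : th P = \sum_(i < size P) g1 P`_i * g2 (b ^+ i).
  rewrite /th /= /horner_morph (@horner_coef_wide _ (size P)) ?size_poly //.
  by apply: eq_bigr => i _; rewrite coef_map rmorphXn.
have ev0 phi : klinear k phi -> ev 0 phi = 0.
  move=> /evP[evD _]; apply: (addIr (ev 0 phi)).
  by rewrite -evD !add0r.
have evth (P : {poly R}) phi : klinear k phi ->
    ev (th P) phi = \sum_(i < size P) P`_i * phi (b ^+ i).
  move=> lphi; have [evD evM] := evP _ lphi; rewrite thE.
  rewrite (big_morph (ev^~ phi) evD (ev0 _ lphi)).
  by apply: eq_bigr => i _; rewrite evM.
have span_lt d i : (i < d)%N -> power_span k b d (b ^+ i).
  move=> id; exists (fun j => (j == i)%:R); split=> //.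
  rewrite (bigD1 (Ordinal id)) //= eqxx mul1r big1 ?addr0 // => j /negPf.
  by rewrite -val_eqE /= => ->; rewrite mul0r.
(* If the top power of b were outside the k-span of the lower ones, a functional killing those and
   equal to 1 at the top power would send th P = 0 to the leading coefficient of P. Thus a relation
   with coefficients in R forces one over k. *)
have key (P : {poly R}) : P != 0 -> th P = 0 ->
    power_span k b (size P).-1 (b ^+ (size P).-1).
  move=> P0 thP; apply: contrapT => nspan.
  have sub := power_span_submodule b (size P).-1 (And4 k1 kD kM kN).
  have [phi [lphi phi0 phi1]] := separating_functional sk sub nspan.
  have := evth P _ lphi; rewrite thP ev0 //.
  have sP : size P = (size P).-1.+1 by rewrite prednK // size_poly_gt0.
  rewrite [in X in _ = X]sP big_ord_recr /= phi1 mulr1 big1 ?add0r => [|i _].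
    by move/esym/eqP; rewrite lead_coef_eq0 (negPf P0).
  by rewrite phi0 ?mulr0 //; apply: span_lt.
have thX : th (('X - b%:P) ^+ n) = 0.
  rewrite rmorphXn rmorphB /= horner_morphX horner_morphC.
  by rewrite -opprB exprNn nil mulr0.
have [d /asboolP spand mind] : exists2 d, `[< power_span k b d (b ^+ d) >] &
    forall e, power_span k b e (b ^+ e) -> (d <= e)%N.
  have ex : exists d, `[< power_span k b d (b ^+ d) >].
    exists n; apply/asboolP; have := key (('X - b%:P) ^+ n).
    by rewrite size_exp_XsubC -size_poly_gt0 size_exp_XsubC; apply.
  by have [d sd md] := ex_minnP ex; exists d => // e se; apply/md/asboolP.
have [c [kc eb]] := spand.
have d0 : (0 < d)%N.
  rewrite lt0n; apply/eqP => d0; move: eb; rewrite d0 big_ord0 expr0 => /eqP.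
  by rewrite oner_eq0.
pose f : {poly R} := 'X^d - \poly_(i < d) c i.
have szf : (size (\poly_(i < d) c i) < size ('X^d : {poly R}))%N.
  by rewrite size_polyXn ltnS size_poly.
have fmon : f \is monic by rewrite monicE lead_coefDl ?size_polyN // lead_coefXn.
have sf : size f = d.+1 by rewrite size_polyDl ?size_polyN // size_polyXn.
(* The coefficients c_i lie in k, so g1 c_i = g2 c_i and the relation for b can be read in the right
   factor alone. *)
have thf : th f = 0.
  rewrite rmorphB rmorphXn /= horner_morphX -rmorphXn eb rmorph_sum /=.
  apply/eqP; rewrite subr_eq0; apply/eqP; rewrite /horner_morph.
  rewrite (@horner_coef_wide _ d); last first.
    by apply: leq_trans (size_poly _ _) (size_poly _ _).
  apply: eq_bigr => i _; rewrite coef_map coef_poly ltn_ord /=.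
  by rewrite g12 // rmorphM rmorphXn.
have := Pdiv.RingMonic.rdivp_eq fmon (('X - b%:P) ^+ n).
set q := Pdiv.Ring.rdivp _ _; set r := Pdiv.Ring.rmodp _ _ => divE.
(* A nonzero remainder would also be killed by [th], and [key] would give a relation of degree below
   d. *)
have r0 : r = 0.
  apply/eqP; apply: contrapT => /negP rn0.
  have rf : (size r <= d)%N.
    by rewrite -ltnS -sf Pdiv.Ring.ltn_rmodpN0 // monic_neq0.
  have /(key _ rn0)/mind : th r = 0.
    have := thX; rewrite divE rmorphD rmorphM /=.
    by rewrite thf mulr0 add0r.
  by rewrite leqNgt prednK ?size_poly_gt0 // rf.
have dbc : d%:R * b = c d.-1.
  apply/eqP; rewrite -subr_eq0; apply/eqP; apply: contrapT => x0.
  have [F [h [_ hx]]] : exists (K : fieldType) (h : {rmorphism R -> K}),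
      perfect K /\ h (d%:R * b - c d.-1) <> 0.
    by apply: perfect_field_sep => m /redR.
  apply: hx; have := congr1 (map_poly h) divE.
  rewrite r0 addr0 rmorphXn rmorphB rmorphM /= map_polyX map_polyC /= => divF.
  have : (map_poly h f %| ('X - (h b)%:P) ^+ n)%R by rewrite divF dvdp_mulIr.
  move=> /dvdp_exp_XsubCP[j _]; rewrite eqp_monic ?monic_map //; last first.
    by rewrite monic_exp // monicXsubC.
  move=> /eqP fj; have := congr1 (size \o val) fj.
  rewrite /= size_map_poly_id0 ?(monicP fmon) ?rmorph1 ?oner_neq0 //.
  rewrite sf size_exp_XsubC => -[jd]; move: fj; rewrite -jd -(prednK d0).
  move=> /(congr1 (fun P : {poly F} => P`_d.-1)).
  have fc : f`_d.-1 = - c d.-1.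
    by rewrite coefB coefXn coef_poly ltn_eqF prednK // leqnn sub0r.
  rewrite coefPn_exp_XsubC coef_map /= fc rmorphN prednK // => /oppr_inj hc.
  by rewrite rmorphB rmorphM rmorph_nat mulr_natl hc subrr.
have [z kz dz] := invk _ (kn d) (ch0 _ d0).
by rewrite -[b]mul1r -dz -mulrA mulrCA dbc; apply: kM.
Qed.

(** Raising to the power p^n >= n gives b^(p^n) (x) 1 = 1 (x) b^(p^n), which forces b^(p^n) into k.
    Roots exist in k and p-th roots are unique in the reduced ring R, so one descends to b. *)
Lemma nilpotent_diff_charp (R T : comNzRingType) (k : R -> Prop)
    (g1 g2 : {rmorphism R -> T}) (ev : T -> (R -> R) -> R) (b : R) (n p : nat) :
  reduced R -> subfield k -> prime p -> p%:R = 0 :> R ->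
  (forall c, k c -> exists2 d, k d & d ^+ p = c) ->
  (forall phi, klinear k phi -> forall x y, ev (g1 x * g2 y) phi = x * phi y) ->
  (g1 b - g2 b) ^+ n = 0 -> k b.
Proof.
move=> redR sk pp p0 rootk evP nil; have [[k1 kD kM kN] invk] := sk.
have root_down m : k (b ^+ (p ^ m)%N) -> k b.
  elim: m => [|m IH]; first by rewrite expr1.
  move=> /rootk[d kd]; rewrite expnSr exprM => /esym/eqP; rewrite -subr_eq0.
  rewrite -[p]expn1 -(frobenius_iterB _ _ _ pp p0) => /eqP/redR/eqP.
  by rewrite subr_eq0 => /eqP bd; apply: IH; rewrite bd.
apply: (root_down n); apply: contrapT => nk.
have sW : submodule k k.
  split=> [| |c x kc kx]; [|exact: kD|exact: kM].
  by rewrite -(addNr 1); apply: kD => //; exact: kN.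
have [phi [lphi phik phib]] := separating_functional sk sW nk.
have pT : p%:R = 0 :> T by rewrite -(rmorph_nat g1) p0 rmorph0.
have : g1 (b ^+ (p ^ n)%N) = g2 (b ^+ (p ^ n)%N).
  apply/eqP; rewrite -subr_eq0 !rmorphXn -(frobenius_iterB _ _ _ pp pT).
  have /subnK <- : (n <= p ^ n)%N by apply/ltnW/ltn_expl/prime_gt1.
  by rewrite exprD nil mulr0.
(* The functional yields 1 on 1 (x) b^(p^n), but b^(p^n) phi(1) = 0 on b^(p^n) (x) 1. *)
move=> e; have := evP _ lphi 1 (b ^+ (p ^ n)%N).
rewrite rmorph1 mul1r -e -[g1 _]mulr1 -(rmorph1 g2) evP // phik // phib mulr0 mul1r.
by move=> /esym/eqP; rewrite oner_eq0.
Qed.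

Lemma perfect_amalgam_sep (R : comNzRingType) (k : R -> Prop) (b : R) :
  reduced R -> subfield k ->
  (forall p, prime p -> p%:R = 0 :> R ->
     forall c, k c -> exists2 d, k d & d ^+ p = c) ->
  ~ k b ->
  exists (K : fieldType) (h1 h2 : {rmorphism R -> K}),
    [/\ perfect K, forall c, k c -> h1 c = h2 c & h1 b <> h2 b].
Proof.
move=> redR sk rootk nkb.
have [T [g1 [g2 [ev [g12 evP]]]]] := tensor_square k.
have [|K [f [perfK fb]]] := @perfect_field_sep T (g1 b - g2 b).
  move=> n nil; apply: nkb.
  have [[p [pp p0]]|ch0] := pselect (exists p, prime p /\ p%:R = 0 :> R).
    apply: (nilpotent_diff_charp redR sk pp p0 (rootk _ pp p0) _ nil).
    by move=> phi /evP[].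
  apply: (nilpotent_diff_char0 redR sk _ g12 evP nil).
  apply: (subfield_natr_neq0 sk); first by apply/eqP/oner_neq0.
  by move=> p pp p0; apply: ch0; exists p.
exists K, (f \o g1), (f \o g2); split=> // [c kc|e]; first by rewrite /= g12.
by apply: fb; rewrite rmorphB /=; apply/eqP; rewrite subr_eq0; apply/eqP.
Qed.

Lemma regular_reduced (R : comPzRingType) :
  (forall x : R, exists y, x * y * x = x) -> reduced R.
Proof.
move=> reg x n xn0; have [y xyx] := reg x.
(* Iterate x = (x y) x. *)
have : x = x ^+ n * y ^+ n * x.
  elim: {xn0} n => [|n IH]; first by rewrite !mul1r.
  rewrite !exprSr (_ : _ * x = x ^+ n * y ^+ n * (x * y * x)); last by ring.
  by rewrite xyx.
by rewrite xn0 !mul0r.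
Qed.

(* R = B/I is the localization of B at a maximal ideal P of A containing
   {a | a b in A}, so that the image k of A in R is the residue field A/P. *)
Lemma regular_ring_field_sep (A B : comPzRingType) (m : {rmorphism A -> B}) (b : B) :
  (forall x y, m x = m y -> x = y) ->
  (forall x : A, exists y, x * y * x = x) ->
  (forall x : B, exists y, x * y * x = x) ->
  (forall p, prime p -> forall a : A, exists r c, r ^+ p = a * (1 - p%:R * c)) ->
  ~ (exists a, m a = b) ->
  exists (K : fieldType) (h1 h2 : {rmorphism B -> K}),
    [/\ perfect K, forall a, h1 (m a) = h2 (m a) & h1 b <> h2 b].
Proof.
move=> minj regA regB rootA nb.
pose J a := exists a', m a * b = m a'.
have idJ : ideal J.
  split=> [|x y [x' ex] [y' ey]|c x _ [x' ex]].
  - by exists 0; rewrite rmorph0 mul0r.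
  - by exists (x' + y'); rewrite !rmorphD mulrDl ex ey.
  - by exists (c * x'); rewrite !rmorphM -mulrA ex.
have nJ1 : ~ J 1 by move=> [a']; rewrite rmorph1 mul1r => ea; apply: nb; exists a'.
have [//|P [[P0 PD PM] JP nP1 maxP]] := @max_submodule A (fun _ => True) J 1 _ idJ nJ1.
have nPM s t : ~ P s -> ~ P t -> ~ P (s * t).
  move=> /maxP[c [w [_ Pw e1]]] nPt Pst; apply: nPt.
  have -> : t = t * w + c * (s * t) by rewrite -[LHS]mulr1 [in LHS]e1; ring.
  by apply: PD; apply: PM.
(* The kernel of inverting the complement of P. No fractions are needed: if s s' s = s with s
   outside P, then s (s s' - 1) = 0, so s is invertible modulo [I]. *)
pose I x := exists s, ~ P s /\ m s * x = 0.
have idI : ideal I.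
  split=> [|x y [s [nPs sx]] [t [nPt ty]]|c x _ [s [nPs sx]]].
  - by exists 1; rewrite mulr0.
  - exists (s * t); split; first exact: nPM.
    rewrite rmorphM (_ : _ * _ = m t * (m s * x) + m s * (m t * y)); last by ring.
    by rewrite sx ty !mulr0 addr0.
  - by exists s; split=> //; rewrite mulrCA sx mulr0.
have [Q [q [qs q0]]] := quotient_ideal idI.
have qE x y : q x = q y <-> I (x - y).
  rewrite -q0 rmorphB; split=> [->|/eqP]; first by rewrite subrr.
  by rewrite subr_eq0 => /eqP.
have /eqP n1 : (1 : Q) <> 0.
  rewrite -(rmorph1 q) => /q0[s [nPs]]; rewrite mulr1 -(rmorph0 m) => /minj s0.
  by apply: nPs; rewrite s0.
pose nz := GRing.PzSemiRing_isNonZero.Build Q n1.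
pose R : comNzRingType := HB.pack Q nz.
have fB : zmod_morphism (q : B -> R) by move=> x y; rewrite rmorphB.
have fM : monoid_morphism (q : B -> R).
  by split=> [|x y]; [exact: (rmorph1 q)|exact: (rmorphM q)].
pose f : {rmorphism B -> R} := mk_rmorphism fB fM.
pose k (x : R) := exists a, x = f (m a).
have redR : reduced R.
  apply: regular_reduced => x; have [y <-] := qs x; have [z yzy] := regB y.
  by exists (f z); rewrite -[RHS]/(f y) -[in RHS]yzy !rmorphM.
have sk : subfield k.
  split; first split.
  - by exists 1; rewrite !rmorph1.
  - by move=> _ _ [x ->] [y ->]; exists (x + y); rewrite !rmorphD.
  - by move=> _ _ [x ->] [y ->]; exists (x * y); rewrite !rmorphM.
  - by move=> _ [x ->]; exists (- x); rewrite !rmorphN.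
  move=> _ [a ->] ma0; have [a' aa'a] := regA a.
  have nPa : ~ P a.
    (* 1 - a' a annihilates a and is outside P, as P misses 1; so P maps to 0 in R. *)
    move=> Pa; apply: ma0; apply/q0; exists (1 - a' * a); split.
      by move=> Ps; apply: nP1; rewrite -(subrK (a' * a) 1); apply: PD => //; apply: PM.
    rewrite -rmorphM mulrBl mul1r (_ : a' * a * a = a * a' * a); last by ring.
    by rewrite aa'a subrr rmorph0.
  exists (f (m a')); first by exists a'.
  rewrite -!rmorphM -(rmorph1 f); apply/qE; exists a; split=> //.
  rewrite mulrBr mulr1 -rmorphM (_ : a * (a * a') = a * a' * a); last by ring.
  by rewrite aa'a subrr.
have rootk p : prime p -> p%:R = 0 :> R ->
    forall c, k c -> exists2 d, k d & d ^+ p = c.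
  move=> pp p0 _ [a ->]; have [r [c er]] := rootA p pp a.
  exists (f (m r)); first by exists r.
  rewrite -!rmorphXn er !(rmorphM, rmorphB) !rmorph_nat !rmorph1.
  by rewrite p0 mul0r subr0 mulr1.
have nkb : ~ k (f b).
  (* s (b - m a) = 0 puts s in [J], which is contained in P. *)
  move=> [a /qE[s [nPs]]]; rewrite mulrBr -rmorphM => /eqP; rewrite subr_eq0 => /eqP e.
  by apply: nPs; apply: JP; exists (s * a).
have [K [h1 [h2 [perfK h12 hb]]]] := perfect_amalgam_sep redR sk rootk nkb.
exists K, (h1 \o f), (h2 \o f); split=> // a /=.
by apply: h12; exists a.
Qed.

(** * The operations on algebras *)

Lemma comm_ring_mulDl (A : RAlg) : comm_ring A -> left_distributive (@rmul A) radd.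
Proof.
move=> [_ [_ [_ [_ [_ [mulC [_ mulD]]]]]]] x y z.
by rewrite mulC mulD (mulC z) (mulC z).
Qed.

(** Carrier and operations are those of A up to conversion, so facts pass between the two without
    transport; decidable equality and choice are classical. *)
Definition ring_of (A : RAlg) (hA : comm_ring A) : comPzRingType :=
  let h2 := proj2 hA in let h3 := proj2 h2 in let h4 := proj2 h3 in
  let h5 := proj2 h4 in let h6 := proj2 h5 in let h7 := proj2 h6 in
  let eqm := gen_eqMixin A in
  let chm := gen_choiceMixin A in
  let C : choiceType := HB.pack (rcar A) eqm chm in
  let zm := GRing.isZmodule.Build C (proj1 hA) (proj1 h2) (proj1 h3) (proj1 h4) in
  let Z : zmodType := HB.pack C zm in
  let rm := GRing.Zmodule_isComPzRing.Build Z (proj1 h5) (proj1 h6) (proj1 h7)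
              (comm_ring_mulDl hA) in
  HB.pack C zm rm.

Lemma ring_of_rpow (A : RAlg) (hA : comm_ring A) (a : A) (n : nat) :
  rpow a n = (a : ring_of hA) ^+ n.
Proof. by elim: n => [|n IH] //=; rewrite exprS -IH. Qed.

Lemma ring_of_rnat (A : RAlg) (hA : comm_ring A) (n : nat) :
  rnat A n = n%:R :> ring_of hA.
Proof. by elim: n => [|n IH] //=; rewrite mulrS -IH. Qed.

Lemma ring_of_reduced (A : RAlg) (hA : comm_ring A) :
  RCR A <-> reduced (ring_of hA).
Proof.
split=> [[_ red] x n xn0|red]; first by apply: (red x n); rewrite (ring_of_rpow hA).
by split=> // a n; rewrite (ring_of_rpow hA) => /red.
Qed.

Lemma ring_of_zmod_morphism (A B : RAlg) (hA : comm_ring A) (hB : comm_ring B)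
    (h : A -> B) :
  rhom A B h -> zmod_morphism (h : ring_of hA -> ring_of hB).
Proof.
by move=> [hD [_ [hN _]]] x y; apply: etrans (hD x (ropp y)) _; rewrite hN.
Qed.

Lemma ring_of_monoid_morphism (A B : RAlg) (hA : comm_ring A) (hB : comm_ring B)
    (h : A -> B) :
  rhom A B h -> monoid_morphism (h : ring_of hA -> ring_of hB).
Proof. by move=> [_ [hM [_ [_ h1]]]]. Qed.

Definition ring_of_hom (A B : RAlg) (hA : comm_ring A) (hB : comm_ring B)
    (h : A -> B) (hh : rhom A B h) : {rmorphism ring_of hA -> ring_of hB} :=
  mk_rmorphism (@ring_of_zmod_morphism A B hA hB h hh)
    (@ring_of_monoid_morphism A B hA hB h hh).

Lemma rhom_rpow (A B : RAlg) (h : A -> B) (a : A) (n : nat) :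
  rhom A B h -> h (rpow a n) = rpow (h a) n.
Proof.
by move=> [_ [hM [_ [_ h1]]]]; elim: n => [|n IH] //=; rewrite hM IH.
Qed.

Lemma rhom_rnat (A B : RAlg) (h : A -> B) (n : nat) :
  rhom A B h -> h (rnat A n) = rnat B n.
Proof.
by move=> [hD [_ [_ [h0 h1]]]]; elim: n => [|n IH] //=; rewrite hD IH h1.
Qed.

(** b = b a b = b (a c a) b = b a c, and symmetrically c = b a c. *)
Lemma weak_inverse_uniq (R : comPzRingType) (a b c : R) :
  a * b * a = a -> b * a * b = b -> a * c * a = a -> c * a * c = c -> b = c.
Proof.
move=> aba bab aca cac.
have -> : b = (b * a * b) * (a * c).
  by rewrite -[LHS]bab -[X in _ * X * _ = _]aca; ring.
have {2}-> : c = (c * a * c) * (a * b).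
  by rewrite -[LHS]cac -[X in _ * X * _ = _]aba; ring.
by rewrite bab cac; ring.
Qed.

(** Put d = x - y. Although p need not vanish in R, p d = 0 kills every inner term of (d + y)^p, so
    x^p = d^p + y^p and d^p = 0. *)
Lemma weak_root_uniq (R : comPzRingType) (p : nat) (x y : R) :
  reduced R -> prime p -> p%:R * x = 0 -> p%:R * y = 0 -> x ^+ p = y ^+ p -> x = y.
Proof.
case: p => [_ //|n] red pp px py exy; apply/eqP; rewrite -subr_eq0; apply/eqP.
apply: (red _ n.+1); pose d := x - y.
have pd : n.+1%:R * d = 0 by rewrite mulrBr px py subrr.
have := exprDn d y n.+1; rewrite subrK exy.
rewrite big_ord_recl big_ord_recr /= subn0 subnn mulr1 mul1r bin0 binn !mulr1n.
rewrite big1 => [|i _]; last first.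
  rewrite /bump /= add1n -mulr_natr.
  have ip : (0 < i.+1 < n.+1)%N by rewrite /= ltnS ltn_ord.
  have /dvdnP[c ->] := prime_dvd_bin pp ip.
  have -> : (n.+1 - i.+1)%N = (n - i.+1).+1 by rewrite subSS subnSK.
  rewrite exprS natrM; set u := _ ^+ _; set v := _ ^+ _.
  by rewrite mulrC -!mulrA [_ * (d * _)]mulrA pd mul0r mulr0.
by rewrite add0r => /eqP; rewrite -subr_eq subrr eq_sym => /eqP.
Qed.

Lemma winv_op_uniq (A : RAlg) (a b c : A) :
  comm_ring A -> winv_op A a b -> winv_op A a c -> b = c.
Proof.
by move=> hA [aba bab] [aca cac]; exact: (@weak_inverse_uniq (ring_of hA) a b c).
Qed.

Lemma wroot_op_uniq (A : RAlg) (p : nat) (a b b' : A) :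
  RCR A -> prime p -> wroot_op p A a b -> wroot_op p A a b' -> b = b'.
Proof.
move=> RA pp [c [pcp [cpc [pb ab]]]] [c' [pcp' [cpc' [pb' ab']]]].
have hA := proj1 RA; have red := proj1 (ring_of_reduced hA) RA.
have cc : c = c' by apply: (winv_op_uniq hA (a := rnat A p)); split.
apply: (@weak_root_uniq (ring_of hA) p b b' red pp).
- by rewrite -ring_of_rnat.
- by rewrite -ring_of_rnat.
- by rewrite -!ring_of_rpow ab ab' cc.
Qed.

Lemma winv_op_hom (A B : RAlg) (h : A -> B) (a b : A) :
  rhom A B h -> winv_op A a b -> winv_op B (h a) (h b).
Proof. by move=> [_ [hM _]] [aba bab]; split; rewrite -!hM ?aba ?bab. Qed.

Lemma wroot_op_hom (A B : RAlg) (h : A -> B) (p : nat) (a b : A) :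
  rhom A B h -> wroot_op p A a b -> wroot_op p B (h a) (h b).
Proof.
move=> hh [c [pcp [cpc [pb ab]]]]; have [hD [hM [hN [h0 h1]]]] := hh.
exists (h c); rewrite -(rhom_rnat p hh) -(rhom_rpow b p hh) -h1 -h0.
by rewrite -!(hM, hN, hD) pcp cpc pb ab.
Qed.

Lemma winv_op_operation : is_operation RCR winv_op.
Proof.
split=> [A [hA _] a b b'|A B h _ _ hh a b]; first exact: winv_op_uniq.
exact: winv_op_hom.
Qed.

Lemma wroot_op_operation (p : nat) : prime p -> is_operation RCR (wroot_op p).
Proof.
move=> pp; split=> [A RA a b b'|A B h _ _ hh a b]; first exact: wroot_op_uniq.
exact: wroot_op_hom.
Qed.

Fixpoint tnat (n : nat) : term :=
  if n is n'.+1 then tAdd tOne (tnat n') else tZero.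

Fixpoint tpow (t : term) (n : nat) : term :=
  if n is n'.+1 then tMul t (tpow t n') else tOne.

Lemma teval_tnat (A : RAlg) (v : nat -> A) (n : nat) : teval A v (tnat n) = rnat A n.
Proof. by elim: n => [|n IH] //=; rewrite IH. Qed.

Lemma teval_tpow (A : RAlg) (v : nat -> A) (t : term) (n : nat) :
  teval A v (tpow t n) = rpow (teval A v t) n.
Proof. by elim: n => [|n IH] //=; rewrite IH. Qed.

Lemma winv_op_pp : pp_definable RCR winv_op.
Proof.
pose x := tVar 0; pose y := tVar 1.
exists [:: (tMul (tMul x y) x, x); (tMul (tMul y x) y, y)] => A _ a b.
by split=> [[aba bab]|[z [aba [bab _]]]] //; exists (fun=> rzero).
Qed.

Lemma wroot_op_pp (p : nat) : pp_definable RCR (wroot_op p).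
Proof.
pose x := tVar 0; pose y := tVar 1; pose z := tVar 2; pose n := tnat p.
exists [:: (tMul (tMul n z) n, n); (tMul (tMul z n) z, z); (tMul n y, tZero);
  (tpow y p, tMul x (tAdd tOne (tOpp (tMul n z))))] => A _ a b.
split=> [[c [pcp [cpc [pb ab]]]]|[w /=]].
  by exists (fun=> c); rewrite /= teval_tpow !teval_tnat.
rewrite teval_tpow !teval_tnat => -[pcp [cpc [pb [ab _]]]].
by exists (w 0%N).
Qed.

Definition icf (K : fieldType) : IAlg :=
  {| icar := K; iadd := +%R; imul := *%R; iopp := -%R; izero := 0; ione := 1;
     iinv := GRing.inv;
     iroot := fun p a =>
       xget 0 [set b : K | (proj1_sig p)%:R = 0 :> K /\ b ^+ proj1_sig p = a] |}.

Lemma icf_comm_ring (K : fieldType) : comm_ring (reduct (icf K)).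
Proof.
do 7?split; [exact: addrA|exact: addrC|exact: add0r|exact: addNr|exact: mulrA|
  exact: mulrC|exact: mul1r|exact: mulrDr].
Qed.

Lemma icf_rpow (K : fieldType) (a : K) (n : nat) :
  rpow (A := reduct (icf K)) a n = a ^+ n.
Proof. by elim: n => [|n IH] //=; rewrite exprS -IH. Qed.

Lemma icf_rnat (K : fieldType) (n : nat) : rnat (reduct (icf K)) n = n%:R :> K.
Proof. by elim: n => [|n IH] //=; rewrite mulrS -IH. Qed.

Lemma ICF_icf (K : fieldType) : perfect K -> ICF (icf K).
Proof.
move=> perfK; split; [split; [split; [|split]|]|split; [|split]].
- exact: icf_comm_ring.
- by move=> /esym/eqP; rewrite oner_eq0.
- by move=> a /eqP a0; exists (a^-1); apply: divff.
- have [[p pK]|ch0] := pselect (exists p, p \in [pchar K]); last first.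
    left=> n n0; rewrite icf_rnat => e; apply: ch0.
    by have [] := natf0_pchar n0 (introT eqP e) => p; exists p.
  right; have /andP[pp /eqP p0] := pK; exists p; split=> //.
  rewrite icf_rnat; split=> // a; have [b ba] := perfK p pK a.
  by exists b; rewrite icf_rpow.
- exact: invr0.
- by move=> a /eqP a0; apply: divff.
- move=> [p pp] a /=; rewrite icf_rnat; split=> [p0|np0]; last first.
    (* Outside characteristic p the set is empty, and the default 0 of [xget] is the required value
       of r_p. *)
    by apply: xgetPN => b [].
  have pK : p \in [pchar K] by apply/andP; split; last apply/eqP.
  have [b ba] := perfK p pK a.
  rewrite icf_rpow; pose S (c : K) := p%:R = 0 :> K /\ c ^+ p = a.
  by case: (@xgetPex _ 0 S) => //; exists b.
Qed.

Lemma ICF_winv (C : IAlg) (a : C) : ICF C -> winv_op (reduct C) a (iinv C a).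
Proof.
move=> [[[hC _] _] [inv0 [mulV _]]]; pose R := ring_of hC.
suff : (a : R) * (iinv C a : R) * (a : R) = a /\
       (iinv C a : R) * (a : R) * (iinv C a : R) = iinv C a by [].
have [->|a0] := pselect (a = 0 :> R).
  by rewrite [iinv C _]inv0; split; rewrite mulr0.
have aV : (a : R) * (iinv C a : R) = 1 by apply: mulV.
by rewrite [X in _ /\ X * _ = _]mulrC aV !mul1r.
Qed.

(** The idempotent 1 - n n^* is 1 in characteristic p and 0 otherwise, which lets one equation cover
    both cases of r_p. *)
Lemma ICF_wroot (C : IAlg) (p : primeT) (a : C) :
  ICF C -> let n := rnat (reduct C) (proj1_sig p) in
  rmul n (iroot C p a : reduct C) = rzero /\
  rpow (iroot C p a : reduct C) (proj1_sig p) =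
    rmul (a : reduct C) (radd rone (ropp (rmul n (iinv C n : reduct C)))).
Proof.
case: p => p pp FC n /=; have [[[hC _] _] [inv0 [mulV rootP]]] := FC.
pose R := ring_of hC; have [/= root0 rootN0] := rootP (exist _ p pp) a.
suff : (n : R) * (iroot C (exist _ p pp) a : R) = 0 /\
       (iroot C (exist _ p pp) a : R) ^+ p = (a : R) * (1 - (n : R) * (iinv C n : R)).
  by rewrite -ring_of_rpow.
have [n0|n0] := pselect (n = 0 :> R).
  by rewrite -ring_of_rpow root0 // n0 !mul0r subr0 mulr1.
have nV : (n : R) * (iinv C n : R) = 1 by apply: mulV.
rewrite [iroot _ _ _]rootN0 // nV subrr; split; first exact: mulr0.
by rewrite mulr0 -[LHS]/((0 : R) ^+ p) expr0n eqn0Ngt prime_gt0.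
Qed.

Lemma ICF_RCR (C : IAlg) : ICF C -> RCR (reduct C).
Proof.
move=> FC; have [[[hC _] _] _] := FC; apply/(ring_of_reduced hC).
apply: regular_reduced => a; exists (iinv C a).
by have [] := ICF_winv a FC.
Qed.

Lemma ICF_RCR_F (C : IAlg) : ICF C -> RCR_F C.
Proof.
move=> FC; split; first exact: ICF_RCR.
split=> [a|p a]; first exact: ICF_winv.
have [pb ab] := ICF_wroot p a FC.
have [ncn cnc] := ICF_winv (rnat (reduct C) (proj1_sig p)) FC.
by exists (iinv C (rnat (reduct C) (proj1_sig p))).
Qed.

Lemma rhom_ihom (B C : IAlg) (h : B -> C) :
  RCR_F B -> RCR_F C -> rhom (reduct B) (reduct C) h -> ihom B C h.
Proof.
move=> [RB [invB rootB]] [RC [invC rootC]] hh; split=> //; split=> [x|p x].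
  apply: (winv_op_uniq (A := reduct C) (proj1 RC) _ (invC (h x))).
  exact: (winv_op_hom hh (invB x)).
apply: (wroot_op_uniq (A := reduct C) RC (proj2_sig p) _ (rootC p (h x))).
exact: (wroot_op_hom hh (rootB p x)).
Qed.

Lemma ihom_comp (A B C : IAlg) (g : B -> C) (h : A -> B) :
  ihom B C g -> ihom A B h -> ihom A C (g \o h).
Proof.
move=> [[gD [gM [gN [g0 g1]]]] [gV gr]] [[hD [hM [hN [h0 h1]]]] [hV hr]].
split; last by split=> [x|p x] /=; rewrite ?hV ?gV ?hr ?gr.
split=> [x y|] /=; first by rewrite hD gD.
split=> [x y|] /=; first by rewrite hM gM.
by split=> [x|] /=; [rewrite hN gN|rewrite h0 g0 h1 g1].
Qed.

Lemma iprod_proj (I : Type) (F : I -> IAlg) (i : I) :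
  ihom (iprod I F) (F i) (fun x => x i).
Proof. by []. Qed.

Lemma ihom_iprod (I : Type) (F : I -> IAlg) (C : IAlg) (h : forall i, C -> F i) :
  (forall i, ihom C (F i) (h i)) -> ihom C (iprod I F) (fun x i => h i x).
Proof.
move=> hh; split; last first.
  by split=> [x|p x]; apply: functional_extensionality_dep => i;
    have [_ [hV hr]] := hh i; [exact: hV|exact: hr].
split=> [x y|]; last split=> [x y|]; last split=> [x|]; last split;
  apply: functional_extensionality_dep => i;
  have [[hD [hM [hN [h0 h1]]]] _] := hh i;
  [exact: hD|exact: hM|exact: hN|exact: h0|exact: h1].
Qed.

(** For the converse, the product is indexed by the pairs of distinct elements, with one separating
    map for each. *)
Lemma ICM_sepP (C : IAlg) :
  ICM C <-> forall x y : C, x <> y ->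
    exists (F : IAlg) (h : C -> F), [/\ ICF F, ihom C F h & h x <> h y].
Proof.
split=> [[I [F [h [FF [hh hinj]]]]] x y nxy|sep].
  have [i nhi] : exists i, h x i <> h y i.
    apply: contrapT => nex; apply: nxy; apply: hinj.
    apply: functional_extensionality_dep => i; apply: contrapT => nhi.
    by apply: nex; exists i.
  exists (F i), (fun x => h x i); split=> //.
  exact: ihom_comp (iprod_proj F i) hh.
pose I := {xy : C * C | xy.1 <> xy.2}.
pose sepI (i : I) := cid (sep _ _ (proj2_sig i)).
pose F i := projT1 (sepI i).
pose h i := projT1 (cid (projT2 (sepI i))).
have hP i : [/\ ICF (F i), ihom C (F i) (h i) & h i (sval i).1 <> h i (sval i).2].
  exact: (projT2 (cid (projT2 (sepI i)))).
exists I, F, (fun x i => h i x); split; first by move=> i; have [] := hP i.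
split; first by apply: ihom_iprod => i; have [] := hP i.
move=> x y exy; apply: contrapT => nxy.
have [_ _] := hP (exist _ (x, y) nxy); apply.
exact: (congr1 (fun z => z (exist _ (x, y) nxy)) exy).
Qed.

(** Ring axioms, reducedness and weak inverses are identities or quasi-identities, so they can be
    checked in the fields. The existential in [wroot_op] becomes an identity too, once its witness
    is the weak inverse of p. *)
Lemma ICM_RCR_F (C : IAlg) : ICM C -> RCR_F C.
Proof.
move=> /ICM_sepP sep.
have sepE x y : (forall F h, ICF F -> ihom C F h -> h x = h y) -> x = y.
  move=> e; apply: contrapT => /sep[F [h [FF hh nh]]].
  by apply: nh; apply: e.
have hC : comm_ring (reduct C).
  split=> [x y z|]; last split=> [x y|]; last split=> [x|]; last split=> [x|];
    last split=> [x y z|]; last split=> [x y|]; last split=> [x|x y z];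
    apply: sepE => F h /ICF_RCR[[DA [DC [D0 [DN [MA [MC [M1 MD]]]]]]] _]
    [[hD [hM [hN [h0 h1]]]] _]; rewrite ?(hD, hM, hN, h0, h1);
    [exact: DA|exact: DC|exact: D0|exact: DN|exact: MA|exact: MC|exact: M1|exact: MD].
split; first split=> // a n an0.
  apply: sepE => F h /ICF_RCR[_ red] [hh _]; have [_ [_ [_ [h0 _]]]] := hh.
  rewrite (h0 : h (izero C) = izero F); apply: (red _ n).
  by rewrite -(rhom_rpow a n hh) an0.
split=> [a|p a].
  split; apply: sepE => F h FF [[_ [hM _]] [hV _]]; rewrite !hM hV;
    by have [aba bab] := ICF_winv (h a) FF.
set n := rnat (reduct C) (proj1_sig p); exists (iinv C n).
do 3?[split]; apply: sepE => F h FF [hh [hV hr]]; have [hD [hM [hN [h0 h1]]]] := hh;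
  rewrite ?(rhom_rpow _ _ hh) ?(hM, hD, hN) ?h0 ?h1 ?hV ?(rhom_rnat _ hh) ?hr;
  have [pb ab] := ICF_wroot p (h a) FF;
  by have [] := ICF_winv (rnat (reduct F) (proj1_sig p)) FF.
Qed.

Lemma rmorphism_rhom (A : RAlg) (hA : comm_ring A) (K : fieldType)
    (f : {rmorphism ring_of hA -> K}) : rhom A (reduct (icf K)) f.
Proof.
split; first exact: (rmorphD f).
split; first exact: (rmorphM f).
split; first exact: (rmorphN f).
by split; [exact: (rmorph0 f)|exact: (rmorph1 f)].
Qed.

Lemma RCR_ICF_sep (A : RAlg) (x y : A) :
  RCR A -> x <> y ->
  exists (F : IAlg) (h : A -> F), [/\ ICF F, rhom A (reduct F) h & h x <> h y].
Proof.
move=> RA nxy; have hA := proj1 RA; have red := proj1 (ring_of_reduced hA) RA.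
have [n xyn|K [f [perfK fxy]]] :=
  @perfect_field_sep (ring_of hA) ((x : ring_of hA) - (y : ring_of hA)).
  by apply: nxy; exact: subr0_eq (red _ _ xyn).
exists (icf K), f; split; [exact: ICF_icf|exact: rmorphism_rhom|move=> e].
by apply: fxy; rewrite rmorphB [f x]e subrr.
Qed.

Lemma RCR_F_ICM (C : IAlg) : RCR_F C -> ICM C.
Proof.
move=> RC; apply/ICM_sepP => x y nxy.
have [F [h [FF hh nh]]] := RCR_ICF_sep (proj1 RC) nxy.
by exists F, h; split=> //; apply: rhom_ihom => //; apply: ICF_RCR_F.
Qed.

Lemma ICM_iprod (I : Type) (F : I -> IAlg) : (forall i, ICF (F i)) -> ICM (iprod I F).
Proof. by move=> FF; exists I, F, id; split=> //; split. Qed.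

Lemma ICM_sub (B C : IAlg) (h : C -> B) :
  ICM B -> ihom C B h -> injective h -> ICM C.
Proof.
move=> [I [F [g [FF [hg ginj]]]]] hh hinj; exists I, F, (g \o h); split=> //.
by split; [exact: ihom_comp hg hh|move=> x y /ginj/hinj].
Qed.

(** A single extension makes all the operations total at once, which gives extendability of each. *)
Lemma RCR_embed (A : RAlg) :
  RCR A -> exists (C : IAlg) (h : A -> C),
    [/\ RCR_F C, rhom A (reduct C) h & injective h].
Proof.
move=> RA; pose I := {xy : A * A | xy.1 <> xy.2}.
pose sepI (i : I) := cid (RCR_ICF_sep RA (proj2_sig i)).
pose F i := projT1 (sepI i).
pose h i := projT1 (cid (projT2 (sepI i))).
have hP i : [/\ ICF (F i), rhom A (reduct (F i)) (h i) &
                 h i (sval i).1 <> h i (sval i).2].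
  exact: (projT2 (cid (projT2 (sepI i)))).
exists (iprod I F), (fun x i => h i x); split.
- by apply: ICM_RCR_F; apply: ICM_iprod => i; have [] := hP i.
- split=> [x y|]; last split=> [x y|]; last split=> [x|]; last split;
    apply: functional_extensionality_dep => i;
    have [_ [hD [hM [hN [h0 h1]]]] _] := hP i;
    [exact: hD|exact: hM|exact: hN|exact: h0|exact: h1].
- move=> x y exy; apply: contrapT => nxy.
  have [_ _] := hP (exist _ (x, y) nxy); apply.
  exact: (congr1 (fun z => z (exist _ (x, y) nxy)) exy).
Qed.

Lemma winv_op_extendable : extendable RCR winv_op.
Proof.
move=> A /RCR_embed[C [h [[RC [invC _]] hh hinj]]] a.
by exists (reduct C), h; do 3?split=> //; exists (iinv C (h a)).
Qed.

Lemma wroot_op_extendable (p : nat) : prime p -> extendable RCR (wroot_op p).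
Proof.
move=> pp A /RCR_embed[C [h [[RC [_ rootC]] hh hinj]]] a.
exists (reduct C), h; do 3?split=> //.
by exists (iroot C (exist _ p pp) (h a)); apply: (rootC (exist _ p pp)).
Qed.

(** * Monomorphisms *)

Lemma kernel_closed (A B : IAlg) (m : A -> B) (hm : ihom A B m) :
  let ker (xy : A * A) := m xy.1 = m xy.2 in
  [/\ forall x y : {xy | ker xy},
        ker (iadd A (sval x).1 (sval y).1, iadd A (sval x).2 (sval y).2),
      forall x y : {xy | ker xy},
        ker (imul A (sval x).1 (sval y).1, imul A (sval x).2 (sval y).2),
      forall x : {xy | ker xy}, ker (iopp A (sval x).1, iopp A (sval x).2),
      forall x : {xy | ker xy}, ker (iinv A (sval x).1, iinv A (sval x).2) &
      forall p (x : {xy | ker xy}), ker (iroot A p (sval x).1, iroot A p (sval x).2)].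
Proof.
have [[mD [mM [mN _]]] [mV mr]] := hm.
split=> [[x ex] [y ey]|[x ex] [y ey]|[x ex]|[x ex]|p [x ex]] /=.
- by rewrite [LHS]mD [RHS]mD ex ey.
- by rewrite [LHS]mM [RHS]mM ex ey.
- by rewrite [LHS]mN [RHS]mN ex.
- by rewrite !mV ex.
- by rewrite !mr ex.
Qed.

Definition kernel_pair (A B : IAlg) (m : A -> B) (hm : ihom A B m) : IAlg :=
  let ker xy := m xy.1 = m xy.2 in
  let cl := kernel_closed hm in
  {| icar := {xy : A * A | ker xy};
     iadd := fun x y => exist ker (_, _) (let: And5 eD _ _ _ _ := cl in eD x y);
     imul := fun x y => exist ker (_, _) (let: And5 _ eM _ _ _ := cl in eM x y);
     iopp := fun x => exist ker (_, _) (let: And5 _ _ eN _ _ := cl in eN x);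
     izero := exist ker (izero A, izero A) erefl;
     ione := exist ker (ione A, ione A) erefl;
     iinv := fun x => exist ker (_, _) (let: And5 _ _ _ eV _ := cl in eV x);
     iroot := fun p x => exist ker (_, _) (let: And5 _ _ _ _ er := cl in er p x) |}.

(** The kernel pair of m is a subalgebra of A x A, hence in ICM. Its projections agree after m, so a
    monomorphism makes them equal. *)
Lemma mono_ICM_injective (A B : IAlg) (m : A -> B) :
  ICM A -> ihom A B m -> mono_in ICM A B m -> injective m.
Proof.
move=> IA hm mono x y exy.
pose T := {xy : A * A | m xy.1 = m xy.2}.
pose pr1 (z : T) := (sval z).1; pose pr2 (z : T) := (sval z).2.
have h1 : ihom (kernel_pair hm) A pr1 by [].
have h2 : ihom (kernel_pair hm) A pr2 by [].
have IK : ICM (kernel_pair hm).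
  apply/ICM_sepP => -[[u1 u2] eu] [[v1 v2] ev] nuv; move/ICM_sepP: IA => sepA.
  have [nuv1|nuv2] : u1 <> v1 \/ u2 <> v2.
    apply: contrapT => nor; apply: nuv; move: eu ev.
    have -> : u1 = v1 by apply: contrapT => n1; apply: nor; left.
    have -> : u2 = v2 by apply: contrapT => n2; apply: nor; right.
    by move=> /= eu ev; congr exist; apply: Prop_irrelevance.
  - have [F [h [FF hh nh]]] := sepA _ _ nuv1.
    by exists F, (h \o pr1); split=> //; apply: ihom_comp hh h1.
  - have [F [h [FF hh nh]]] := sepA _ _ nuv2.
    by exists F, (h \o pr2); split=> //; apply: ihom_comp hh h2.
exact: (mono _ _ _ IK h1 h2 (fun z : T => proj2_sig z) (exist _ (x, y) exy)).
Qed.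

(** The dominion of A in B consists of the elements at which any two homomorphisms agreeing on A
    agree; here it is A itself. *)
Lemma RCR_F_dominion (A B : IAlg) (m : A -> B) (b : B) :
  RCR_F A -> RCR_F B -> ihom A B m -> injective m -> ~ (exists a, m a = b) ->
  exists (F : IAlg) (g1 g2 : B -> F),
    [/\ ICF F, ihom B F g1, ihom B F g2, forall a, g1 (m a) = g2 (m a) &
        g1 b <> g2 b].
Proof.
move=> RA RB [hm _] minj nb.
have [[hA _] [invA rootA]] := RA; have [[hB _] [invB _]] := RB.
have [|||K [h1 [h2 [perfK h12 hb]]]] :=
  @regular_ring_field_sep _ _ (ring_of_hom hA hB hm) b minj _ _ _ nb.
- by move=> x; exists (iinv A x); have [] := invA x.
- by move=> x; exists (iinv B x); have [] := invB x.
- move=> p pp a; have [c [_ [_ [_ e]]]] := rootA (exist _ p pp) a.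
  exists (iroot A (exist _ p pp) a), c.
  by rewrite -(ring_of_rpow hA) -(ring_of_rnat hA); apply: e.
have FF := ICF_icf perfK.
exists (icf K), h1, h2; split=> //; apply: (rhom_ihom RB (ICF_RCR_F FF));
  exact: rmorphism_rhom.
Qed.

(** Each b outside the image of m has its own separating pair; the product of the targets merges
    them into one parallel pair whose equalizer is that image. *)
Lemma RCR_F_regular (A B : IAlg) (m : A -> B) :
  RCR_F A -> RCR_F B -> ihom A B m -> injective m -> regular_in ICM A B m.
Proof.
move=> RA RB hm minj; pose I := {b : B | ~ exists a, m a = b}.
pose dom (i : I) := cid (RCR_F_dominion RA RB hm minj (proj2_sig i)).
pose F i := projT1 (dom i).
pose dom1 i := cid (projT2 (dom i)); pose f1 i := projT1 (dom1 i).
pose dom2 i := cid (projT2 (dom1 i)); pose f2 i := projT1 (dom2 i).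
have fP i : [/\ ICF (F i), ihom B (F i) (f1 i), ihom B (F i) (f2 i),
    forall a, f1 i (m a) = f2 i (m a) & f1 i (sval i) <> f2 i (sval i)].
  exact: (projT2 (dom2 i)).
exists (iprod I F), (fun x i => f1 i x), (fun x i => f2 i x).
split; first by apply: ICM_iprod => i; have [] := fP i.
split; first by apply: ihom_iprod => i; have [] := fP i.
split; first by apply: ihom_iprod => i; have [] := fP i.
split=> [a|C k _ hk eqk].
  by apply: functional_extensionality_dep => i; have [_ _ _] := fP i.
have im x : exists a, m a = k x.
  apply: contrapT => nim; have [_ _ _ _] := fP (exist _ (k x) nim); apply.
  exact: (congr1 (fun z => z (exist _ (k x) nim)) (eqk x)).
split=> [|u u' _ _ uk u'k x]; last by apply: (minj); rewrite uk u'k.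
pose u x := projT1 (cid (im x)); exists u.
have uk x : m (u x) = k x by rewrite /u; case: cid.
split=> //.
have [[mD [mM [mN [m0 m1]]]] [mV mr]] := hm.
have [[kD [kM [kN [k0 k1]]]] [kV kr]] := hk.
split; last by split=> [x|p x]; apply: (minj); rewrite ?mV ?mr !uk ?kV ?kr.
split=> [x y|]; first by apply: (minj); rewrite mD !uk kD.
split=> [x y|]; first by apply: (minj); rewrite mM !uk kM.
split=> [x|]; first by apply: (minj); rewrite mN !uk kN.
by split; apply: (minj); rewrite uk ?m0 ?k0 ?m1 ?k1.
Qed.

Theorem mainTheorem1 :
  (* F = {weak inverse} u {weak p-root : p prime} consists of pp definable
     extendable implicit operations of RCR *)
  (ppdef_ext_op RCR winv_op /\
   forall p : nat, prime p -> ppdef_ext_op RCR (wroot_op p)) /\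
  (* ICM is the pp expansion of RCR induced by F ... *)
  (forall C : IAlg, ICM C <-> SClass RCR_F C) /\
  (* ... and it is simple *)
  (forall C : IAlg, ICM C <-> RCR_F C) /\
  (* every monomorphism in ICM is regular *)
  (forall (A B : IAlg) (m : A -> B), ICM A -> ICM B -> ihom A B m ->
     mono_in ICM A B m -> regular_in ICM A B m).
Proof.
split; last split; last split.
- split=> [|p pp]; split.
  + exact: winv_op_operation.
  + by split; [exact: winv_op_pp|exact: winv_op_extendable].
  + exact: wroot_op_operation.
  + by split; [exact: wroot_op_pp|exact: wroot_op_extendable].
- move=> C; split=> [/ICM_RCR_F RC|[B [h [/RCR_F_ICM IB [hh hinj]]]]].
    by exists C, id; split=> //; split.
  exact: ICM_sub IB hh hinj.
- by move=> C; split; [exact: ICM_RCR_F|exact: RCR_F_ICM].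
- move=> A B m IA IB hm mono; apply: RCR_F_regular => //; try exact: ICM_RCR_F.
  exact: mono_ICM_injective mono.
Qed.
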